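(* Let $\bar d$ denote either $\bar d_1$ or $\bar d_2$, the quotient pseudometric on the space $\bar X$ of ordered tree-like shapes induced by $d_1$ or $d_2$ on $X$, respectively. Then $\bar d$ is a metric on $\bar X$, and $(\bar X,\bar d)$ is a contractible, complete, proper geodesic space.
   Context: Setting. Fix integers $d,n\ge 1$ (in the paper $d=2$ or $3$) and a finite rooted ordered (planar) binary tree $\mathscr T=(V,E,r)$ with $E\neq\emptyset$: every non-leaf vertex has exactly two children, and the children of each vertex are totally ordered. The tree pre-shape space is the vector space $X=\prod_{e\in E}(\mathbb R^d)^n$, with elements $x=(x_e)_{e\in E}$. On $X$ consider the metrics $d_1(x,y)=\sum_{e\in E}\|x_e-y_e\|$ and $d_2(x,y)=\sqrt{\sum_{e\in E}\|x_e-y_e\|^2}$, where $\|\cdot\|$ is the Euclidean norm on $(\mathbb R^d)^n$. Equivalence. For $x\in X$, the collapsed tree of $x$ is the rooted ordered tree with edge attributes obtained from $\mathscr T$ by contracting every edge $e$ with $x_e=0$ (when an edge from $u$ down to $v$ is contracted, the children of $v$ are inserted, in order, at the position of $v$ among the children of $u$) and keeping the attribute $x_e$ on each remaining edge. Put $x\sim y$ iff the collapsed trees of $x$ and $y$ are isomorphic as rooted ordered trees with edge attributes. The space of ordered tree-like shapes is the quotient $\bar X=X/\sim$; write $\bar x$ for the class of $x$. Quotient pseudometric. For a metric $d$ on $X$, $$\bar d(\bar x,\bar y)=\inf\Big\{\sum_{i=1}^k d(x_i,y_i)\ :\ k\ge 1,\ x_1\in\bar x,\ y_i\sim x_{i+1}\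 (1\le i<k),\ y_k\in\bar y\Big\}.$$ A metric space is proper if its closed bounded subsets are compact; it is geodesic if any two points are joined by a path whose length equals their distance. *)

(* Defs.v *)
(* MathComp / MathComp-Analysis. *)
From HB Require Import structures.
From mathcomp Require Import all_boot all_order all_algebra generic_quotient.
From mathcomp Require Import all_classical all_reals all_analysis.

Set Implicit Arguments.
Unset Strict Implicit.
Unset Printing Implicit Defensive.

Import Order.TTheory GRing.Theory Num.Theory.
Import numFieldNormedType.Exports.

Local Open Scope classical_set_scope.
Local Open Scope ring_scope.

Inductive btree : Type := Leaf | Node of btree & btree.

(* The edges of [Node l r], each named by its lower endpoint: [inl None] and
   [inr None] lead to the left and right child of the root, [inl (Some e)] and
   [inr (Some e)] are the edges of the two subtrees. *)
Fixpoint edge (t : btree) : finType :=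
  match t with
  | Leaf => void
  | Node l r => (option (edge l) + option (edge r))%type
  end.

(* Finite rooted ordered trees with attributes in A on the edges; a node is the
   list of its child edges, each with the subtree below it. As vertices carry no
   names, a term is an isomorphism class and isomorphism is Leibniz equality. *)
Inductive otree (A : Type) : Type := ONode of seq (A * otree A).

(* Position of a child whose edge has attribute a and whose own child list is s,
   in the child list of its parent: if a = 0 the edge is contracted. *)
Definition graft (A : nmodType) (a : A) (s : seq (A * otree A)) :
    seq (A * otree A) :=
  if a == 0 then s else [:: (a, ONode s)].

Fixpoint collapsed_children (A : nmodType) (t : btree) :
    (edge t -> A) -> seq (A * otree A) :=
  match t return (edge t -> A) -> seq (A * otree A) with
  | Leaf => fun=> [::]
  | Node l r => fun x =>
      graft (x (inl None)) (collapsed_children (fun e => x (inl (Some e)))) ++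
      graft (x (inr None)) (collapsed_children (fun e => x (inr (Some e))))
  end.

Definition collapsed_tree (A : nmodType) (t : btree) (x : edge t -> A) :
    otree A :=
  ONode (collapsed_children x).

(* Row k of an n x d matrix is the k-th point of an element of (R^d)^n. *)
Definition preshape (R : realType) (d n : nat) (t : btree) : Type :=
  {ffun edge t -> 'M[R]_(n, d)}.

HB.instance Definition _ (R : realType) (d n : nat) (t : btree) :=
  GRing.Zmodule.on (preshape R d n t).

(* The library norm on matrices is the sup norm. *)
Definition enorm (R : realType) (d n : nat) (v : 'M[R]_(n, d)) : R :=
  Num.sqrt (\sum_i \sum_j v i j ^+ 2).

Definition dist1 (R : realType) (d n : nat) (t : btree)
    (x y : preshape R d n t) : R :=
  \sum_(e : edge t) enorm (x e - y e).

Definition dist2 (R : realType) (d n : nat) (t : btree)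
    (x y : preshape R d n t) : R :=
  Num.sqrt (\sum_(e : edge t) enorm (x e - y e) ^+ 2).

Definition shape_sim (R : realType) (d n : nat) (t : btree) :
    rel (preshape R d n t) :=
  fun x y => `[< collapsed_tree x = collapsed_tree y >].

Lemma shape_sim_refl (R : realType) (d n : nat) (t : btree) :
  reflexive (@shape_sim R d n t).
Proof. by move=> x; apply/asboolP. Qed.

Lemma shape_sim_sym (R : realType) (d n : nat) (t : btree) :
  symmetric (@shape_sim R d n t).
Proof. by move=> x y; apply/asboolP/asboolP => ->. Qed.

Lemma shape_sim_trans (R : realType) (d n : nat) (t : btree) :
  transitive (@shape_sim R d n t).
Proof. by move=> y x z /asboolP xy /asboolP yz; apply/asboolP; rewrite xy. Qed.

Definition shape_equiv (R : realType) (d n : nat) (t : btree) :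
    equiv_rel (preshape R d n t) :=
  EquivRel (@shape_sim R d n t) (@shape_sim_refl R d n t)
    (@shape_sim_sym R d n t) (@shape_sim_trans R d n t).

Definition treeshape (R : realType) (d n : nat) (t : btree) : Type :=
  {eq_quot shape_equiv R d n t}%qT.

HB.instance Definition _ (R : realType) (d n : nat) (t : btree) :=
  Choice.on (treeshape R d n t).
HB.instance Definition _ (R : realType) (d n : nat) (t : btree) :=
  EqQuotient.on (treeshape R d n t).

Definition shape_class (R : realType) (d n : nat) (t : btree)
    (x : preshape R d n t) : treeshape R d n t :=
  (\pi_(treeshape R d n t) x)%qT.

(* Only the values x i, y i with i < k are used. *)
Definition chain_lengths (R : realType) (d n : nat) (t : btree)
    (D : preshape R d n t -> preshape R d n t -> R) (a b : treeshape R d n t) :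
    set R :=
  [set s | exists (k : nat) (x y : nat -> preshape R d n t),
    [/\ (1 <= k)%N,
        shape_class (x 0%N) = a,
        (forall i, (i.+1 < k)%N -> shape_sim (y i) (x i.+1)),
        shape_class (y k.-1) = b
      & s = \sum_(i < k) D (x i) (y i)]].

Definition quot_dist (R : realType) (d n : nat) (t : btree)
    (D : preshape R d n t -> preshape R d n t -> R) (a b : treeshape R d n t) : R :=
  inf (chain_lengths D a b).

Record is_metric (R : realType) (M : Type) (D : M -> M -> R) : Prop := {
  is_metric_refl : forall x, D x x = 0;
  is_metric_sep : forall x y, D x y = 0 -> x = y;
  is_metric_sym : forall x y, D x y = D y x;
  is_metric_triangle : forall y x z, D x z <= D x y + D y z
}.

(* The set M with the topology, uniformity and distance defined by D. *)
Definition metric_space (R : realType) (M : choiceType) (D : M -> M -> R)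
    (H : is_metric D) : Type := M.

HB.instance Definition _ (R : realType) (M : choiceType) (D : M -> M -> R)
    (H : is_metric D) := Choice.on (metric_space H).
HB.instance Definition _ (R : realType) (M : choiceType) (D : M -> M -> R)
    (H : is_metric D) :=
  @isMetric.Build R (metric_space H) D (is_metric_refl H) (is_metric_sep H)
    (is_metric_sym H) (is_metric_triangle H).

Definition contractible (R : realType) (M : topologicalType) : Prop :=
  exists (p : M) (h : M * R -> M),
    [/\ {within [set: M] `*` `[0, 1], continuous h},
        forall x, h (x, 0) = x
      & forall x, h (x, 1) = p].

(* The library's [cvg] requires a pointed space. *)
Definition complete_space (M : uniformType) : Prop :=
  forall F : set_system M, ProperFilter F -> cauchy F -> exists l : M, F --> l.

Definition proper_space (R : realType) (M : metricType R) : Prop :=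
  forall A : set M, closed A ->
    (exists r : R, forall x y, A x -> A y -> mdist x y <= r) -> compact A.

(* As [variation], [variations] and [total_variation] for real functions. *)
Definition path_variation (R : realType) (M : metricType R) (a b : R)
    (f : R -> M) (s : seq R) : R :=
  let F := f \o nth b (a :: s) in
  \sum_(0 <= i < size s) mdist (F i) (F i.+1).

Definition path_length (R : realType) (M : metricType R) (a b : R)
    (f : R -> M) : \bar R :=
  ereal_sup [set (path_variation a b f s)%:E | s in itv_partition a b].

Definition geodesic_space (R : realType) (M : metricType R) : Prop :=
  forall x y : M, exists f : R -> M,
    [/\ {within `[0, 1], continuous f},
        f 0 = x, f 1 = y
      & path_length 0 1 f = (mdist x y)%:E].

(* Main.v *)
(* Equivalent pre-shapes arise from one another by moving the nonzero attributes
   to other edges, in a way that only depends on the two supports.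
   Such a relabelling extends to a D-isometry, preserving classes, on all
   pre-shapes with the same or a smaller support. If D x z is smaller than every
   nonzero attribute of x, then the support of x lies in that of z, so x can be
   carried along any relabelling of z: a chain shorter than this threshold can
   never leave the D-neighbourhood of the class of x, and as each edge takes only
   finitely many values on this class the pseudometric separates points.

   The norm D x 0 is constant on classes and 1-Lipschitz for the quotient metric,
   hence bounded sets lift to bounded sets of the finite-dimensional space of
   pre-shapes; this gives properness, and completeness follows. Chains of length
   s are 1-Lipschitz images of [0, s], so by compactness of balls almost shortest
   paths converge to geodesics. Scaling attributes contracts the space. *)
Require Import Defs.
From HB Require Import structures.
From mathcomp Require Import all_boot all_order all_algebra generic_quotient.
From mathcomp Require Import all_classical all_reals all_analysis.
From mathcomp Require Import ring lra.

Set Implicit Arguments.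
Unset Strict Implicit.
Unset Printing Implicit Defensive.

Import Order.TTheory GRing.Theory Num.Theory.
Import numFieldNormedType.Exports.

Local Open Scope classical_set_scope.
Local Open Scope ring_scope.

(** * Collapsed trees *)

(** The result is a child list rather than a tree, because contracting the edge above splices this
    list into the one of the parent. *)
Fixpoint otree_contract (A : Type) (B : nmodType) (g : A -> B) (T : otree A) :
    seq (B * otree B) :=
  let: ONode s := T in
  flatten [seq let: (a, T') := p in graft (g a) (otree_contract g T') | p <- s].

Fixpoint otree_map (A B : Type) (g : A -> B) (T : otree A) : otree B :=
  let: ONode s := T in
  ONode [seq let: (a, T') := p in (g a, otree_map g T') | p <- s].

Fixpoint otree_sum (A : Type) (V : nmodType) (F : A -> V) (T : otree A) : V :=
  let: ONode s := T in
  foldr (fun p v => let: (a, T') := p in F a + otree_sum F T' + v) 0 s.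

Lemma otree_sum_cat (A : Type) (V : nmodType) (F : A -> V)
    (s1 s2 : seq (A * otree A)) :
  otree_sum F (ONode (s1 ++ s2)) =
  otree_sum F (ONode s1) + otree_sum F (ONode s2).
Proof.
elim: s1 => [|[a T] s1 IH] /=; first by rewrite add0r.
by rewrite /= in IH; rewrite IH addrA.
Qed.

Lemma sum_edge_Node (V : nmodType) (l r : btree) (F : edge (Node l r) -> V) :
  \sum_e F e = (F (inl None) + \sum_e F (inl (Some e))) +
               (F (inr None) + \sum_e F (inr (Some e))).
Proof.
have sumO (T : finType) (G : option T -> V) :
  \sum_(i : option T) G i = G None + \sum_i G (Some i).
  rewrite (bigD1 None) //=; congr (_ + _).
  rewrite (reindex_omap Some id) => [|[] //]; apply: eq_bigl => i /=.
  by rewrite eqxx.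
rewrite /= big_sumType /= !sumO; congr (_ + _).
Qed.

Section Collapse.
Variables (A B : nmodType).

(** Since [g 0 = 0], an edge contracted for [x] is also contracted for [g \o x], so contracting in
    two stages is harmless. Scaling and projections of attributes therefore respect equivalence. *)
Lemma contract_collapsed (t : btree) (g : A -> B) (x : edge t -> A) :
  g 0 = 0 -> otree_contract g (collapsed_tree x) = collapsed_children (g \o x).
Proof.
move=> g0; elim: t x => [|l IHl r IHr] x //.
have gr a s : otree_contract g (ONode (graft a s)) = graft (g a) (otree_contract g (ONode s)).
  by rewrite /graft; case: eqP => [->|_] /=; rewrite ?g0 ?eqxx ?cats0.
rewrite /= map_cat flatten_cat -2!/(otree_contract g (ONode _)) !gr.
by congr (graft _ _ ++ graft _ _); [exact: IHl|exact: IHr].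
Qed.

Lemma map_collapsed (t : btree) (g : A -> B) (x : edge t -> A) :
  g 0 = 0 -> (forall e, g (x e) = 0 -> x e = 0) ->
  otree_map g (collapsed_tree x) = collapsed_tree (g \o x).
Proof.
move=> g0; rewrite /collapsed_tree.
elim: t x => [|l IHl r IHr] x gx //.
have gr e s s' : otree_map g (ONode s) = ONode s' ->
    [seq let: (a, T') := p in (g a, otree_map g T') | p <- graft (x e) s] =
    graft (g (x e)) s'.
  move=> [] <-; rewrite /graft; case: (eqVneq (x e)) => [->|xe].
    by rewrite g0 eqxx.
  by case: eqP => [/gx/eqP|//]; rewrite (negPf xe).
rewrite /= map_cat; congr (ONode (_ ++ _)); apply: gr.
- by apply: IHl => e; apply: gx.
- by apply: IHr => e; apply: gx.
Qed.

(** Contracted edges contribute [F 0 = 0]. Such sums are thus invariants of the class, with values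
    in any commutative monoid. *)
Lemma sum_collapsed (t : btree) (F : A -> B) (x : edge t -> A) :
  F 0 = 0 -> \sum_e F (x e) = otree_sum F (collapsed_tree x).
Proof.
move=> F0; rewrite /collapsed_tree; elim: t x => [|l IHl r IHr] x.
  by rewrite big1 //; case.
have gr a s : otree_sum F (ONode (graft a s)) = F a + otree_sum F (ONode s).
  by rewrite /graft; case: eqP => [->|_] /=; rewrite ?F0 ?add0r ?addr0.
rewrite sum_edge_Node (IHl (fun e => x (inl (Some e)))).
by rewrite (IHr (fun e => x (inr (Some e)))) otree_sum_cat !gr.
Qed.

End Collapse.

(** This produces the relabelling: every edge of [T] sits over an edge where [x] is nonzero and
    hands it its second attribute, while the contracted edges receive 0. *)
Lemma collapsed_lift (A B : nmodType) (t : btree) (x : edge t -> A)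
    (T : otree (A * B)) :
  otree_map fst T = collapsed_tree x ->
  exists2 w : edge t -> A * B, fst \o w = x & collapsed_tree w = T.
Proof.
case: T => s [] /=; set f := (X in map X _) => sx.
suff: exists2 w : edge t -> A * B, fst \o w = x & collapsed_children w = s.
  by move=> [w wx ws]; exists w => //; rewrite /collapsed_tree ws.
elim: t x s sx => [|l IHl r IHr] x s /=.
  by case: s => // _; exists (fun e : void => match e with end) => //; apply/funext => -[].
set sl := graft (x (inl None)) _; set sr := graft (x (inr None)) _ => sx.
(* A single edge with its subtree. If [a] is 0, the pair 0 keeps the edge contracted; otherwise [s']
   is a singleton and its attribute is nonzero because its first component is. *)
have lift1 (t : btree) (y : edge t -> A) (a : A) (s' : seq _) :
    (forall s, map f s = collapsed_children y ->
      exists2 w : edge t -> A * B, fst \o w = y & collapsed_children w = s) ->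
    map f s' = graft a (collapsed_children y) ->
    exists c : A * B, exists w : edge t -> A * B,
      [/\ c.1 = a, fst \o w = y & graft c (collapsed_children w) = s'].
  move=> IH; rewrite /graft; case: (eqVneq a 0) => [a0 /IH[w wy ws]|a0].
    by exists 0, w; rewrite eqxx a0.
  case: s' => [//|[c [s'']] [|//]] /= [ca /IH[w wy ws]].
  exists c, w; split=> //; case: eqP => [c0|_]; last by rewrite ws.
  by move: a0; rewrite -ca c0 eqxx.
have szl : (size sl <= size s)%N.
  by rewrite -(size_map f) sx size_cat leq_addr.
(* The first [size sl] children come from the left branch, the others from the right one. *)
have := sx; rewrite -{1}(cat_take_drop (size sl) s) map_cat => def_s.
have hl : map f (take (size sl) s) = sl.
  have := congr1 (take (size sl)) def_s.
  by rewrite !take_size_cat // size_map size_takel.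
have hr : map f (drop (size sl) s) = sr.
  have := congr1 (drop (size sl)) def_s.
  by rewrite !drop_size_cat // size_map size_takel.
have [cl [wl [cla wlx wls]]] := lift1 _ _ _ _ (IHl _) hl.
have [cr [wr [cra wrx wrs]]] := lift1 _ _ _ _ (IHr _) hr.
exists (fun e : edge (Node l r) => match e with
  | inl None => cl | inl (Some e) => wl e
  | inr None => cr | inr (Some e) => wr e end); last first.
  by rewrite /= wls wrs cat_take_drop.
apply/funext => -[[e|]|[e|]] //=.
- by have := congr1 (fun h => h e) wlx.
- by have := congr1 (fun h => h e) wrx.
Qed.

(** * Euclidean norms *)

Section SumOfSquares.
Variables (R : rcfType) (I : finType).
Implicit Types f g : I -> R.

Lemma sum_sqr_ge0 f : 0 <= \sum_i f i ^+ 2.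
Proof. by apply: sumr_ge0 => i _; apply: sqr_ge0. Qed.

(** With [a] and [b] the two norms, expanding the sum of the squares of [b * f i - a * g i] gives
    [2ab(ab - s) >= 0]; the case [ab = 0] is treated apart. *)
Lemma cauchy_schwarz_sum f g :
  \sum_i f i * g i <= Num.sqrt (\sum_i f i ^+ 2) * Num.sqrt (\sum_i g i ^+ 2).
Proof.
set a := Num.sqrt _; set b := Num.sqrt _.
have a2 : a ^+ 2 = \sum_i f i ^+ 2 by rewrite sqr_sqrtr // sum_sqr_ge0.
have b2 : b ^+ 2 = \sum_i g i ^+ 2 by rewrite sqr_sqrtr // sum_sqr_ge0.
have a0 : 0 <= a by exact: sqrtr_ge0.
have b0 : 0 <= b by exact: sqrtr_ge0.
have vanish (h : I -> R) : \sum_i h i ^+ 2 = 0 -> forall i, h i = 0.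
  move=> h0 i; apply/eqP; rewrite -sqrf_eq0; apply/eqP.
  exact: (psumr_eq0P (fun i _ => sqr_ge0 (h i)) h0).
have [a_eq0|a_neq0] := eqVneq a 0.
  rewrite big1 ?mulr_ge0// => i _.
  by rewrite (vanish f) ?mul0r// -a2 a_eq0 expr0n.
have [b_eq0|b_neq0] := eqVneq b 0.
  rewrite big1 ?mulr_ge0// => i _.
  by rewrite (vanish g) ?mulr0// -b2 b_eq0 expr0n.
have ab0 : 0 < a * b by rewrite mulr_gt0// lt_def ?a_neq0 ?b_neq0.
have := sum_sqr_ge0 (fun i => b * f i - a * g i).
rewrite (eq_bigr (fun i => b ^+ 2 * f i ^+ 2 + a ^+ 2 * g i ^+ 2
  - (2 * (a * b)) * (f i * g i))); last by move=> i _; ring.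
rewrite !big_split /= sumrN -!mulr_sumr -a2 -b2.
set s := \sum_i _ => h.
suff : 0 <= (2 * (a * b)) * (a * b - s).
  by rewrite pmulr_rge0 ?subr_ge0// mulr_gt0.
by rewrite (le_trans h)// le_eqVlt; apply/orP; left; apply/eqP; ring.
Qed.

Lemma minkowski_sum f g :
  Num.sqrt (\sum_i (f i + g i) ^+ 2) <=
  Num.sqrt (\sum_i f i ^+ 2) + Num.sqrt (\sum_i g i ^+ 2).
Proof.
rewrite -[leRHS]ger0_norm ?addr_ge0 ?sqrtr_ge0// -sqrtr_sqr ler_wsqrtr//.
rewrite sqrrD !sqr_sqrtr ?sum_sqr_ge0//.
rewrite (eq_bigr (fun i => f i ^+ 2 + (f i * g i) *+ 2 + g i ^+ 2)); last first.
  by move=> i _; rewrite sqrrD.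
by rewrite 2!big_split /= sumrMnl lerD2r lerD2l lerMn2r cauchy_schwarz_sum.
Qed.

End SumOfSquares.

Section EuclideanNorm.
Variables (R : realType) (d n : nat).
Implicit Types u v : 'M[R]_(n, d).

Lemma enorm_pairE v :
  enorm v = Num.sqrt (\sum_(p : 'I_n * 'I_d) v p.1 p.2 ^+ 2).
Proof. by rewrite /enorm pair_bigA. Qed.

Lemma enorm_ge0 v : 0 <= enorm v.
Proof. exact: sqrtr_ge0. Qed.

Lemma enormZ (a : R) v : enorm (a *: v) = `|a| * enorm v.
Proof.
rewrite !enorm_pairE -sqrtr_sqr -sqrtrM ?sqr_ge0// mulr_sumr.
by congr Num.sqrt; apply: eq_bigr => p _; rewrite mxE exprMn.
Qed.

Lemma enorm0 : enorm (0 : 'M[R]_(n, d)) = 0.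
Proof. by rewrite -[0](scale0r 0) enormZ normr0 mul0r. Qed.

Lemma enormB u v : enorm (u - v) = enorm (v - u).
Proof. by rewrite -opprB -scaleN1r enormZ normrN1 mul1r. Qed.

Lemma enormD u v : enorm (u + v) <= enorm u + enorm v.
Proof.
rewrite !enorm_pairE.
rewrite [X in Num.sqrt X](eq_bigr (fun p => (u p.1 p.2 + v p.1 p.2) ^+ 2)).
  exact: minkowski_sum.
by move=> p _; rewrite mxE.
Qed.

Lemma enorm_ge_entry v i j : `|v i j| <= enorm v.
Proof.
rewrite enorm_pairE -sqrtr_sqr ler_wsqrtr// (bigD1 (i, j))//= lerDl.
by apply: sumr_ge0 => p _; apply: sqr_ge0.
Qed.

Lemma enorm_eq0 v : enorm v = 0 -> v = 0.
Proof.
move=> v0; apply/matrixP => i j; rewrite mxE; apply/eqP.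
by rewrite -normr_le0 -v0 enorm_ge_entry.
Qed.

Lemma enorm_le_entries v (eta : R) :
  0 <= eta -> (forall i j, `|v i j| <= eta) -> enorm v <= eta *+ (n * d).
Proof.
move=> eta0 ve; rewrite enorm_pairE -[leRHS]ger0_norm ?mulrn_wge0//.
rewrite -sqrtr_sqr ler_wsqrtr//.
apply: (@le_trans _ _ (\sum_(p : 'I_n * 'I_d) eta ^+ 2)).
  by apply: ler_sum => p _; rewrite -real_normK ?num_real// lerXn2r ?nnegrE.
rewrite sumr_const card_prod !card_ord exprMn_n ler_wpMn2l ?sqr_ge0//.
by case: (n * d)%N => // k; rewrite expnS expn1 leq_pmulr.
Qed.

End EuclideanNorm.

Lemma le_sqrt_sum_sqr (R : rcfType) (I : finType) (f : I -> R) :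
  (forall i, 0 <= f i) -> Num.sqrt (\sum_i f i ^+ 2) <= \sum_i f i.
Proof.
move=> f0; have s0 : 0 <= \sum_i f i by apply: sumr_ge0.
rewrite -[leRHS]ger0_norm// -sqrtr_sqr ler_wsqrtr// expr2 mulr_suml.
apply: ler_sum => i _; rewrite expr2 ler_wpM2l//.
by rewrite (bigD1 i)//= lerDl sumr_ge0.
Qed.

Lemma finite_pos_lower_bound (R : realDomainType) (I : finType)
    (f : I -> R) :
  exists2 delta, 0 < delta & forall i, 0 < f i -> delta <= f i.
Proof.
(* The default 1 serves when [f] has no positive value. *)
exists (\big[Order.min/1]_(i | 0 < f i) f i).
  by apply: lt_bigmin.
by move=> i fi; apply: bigmin_le_cond.
Qed.

(** * Metrics on the space of pre-shapes *)

HB.instance Definition _ (R : realType) (d n : nat) (t : btree) :=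
  GRing.Lmodule.on (preshape R d n t).

(** The common properties through which both metrics are handled at once. The sums in [pm_relabel]
    determine the multiset of nonzero pairs [(x e, y e)], so the field says that [D x y] depends on
    this multiset only. *)
Record preshape_metric (R : realType) (d n : nat) (t : btree)
    (D : preshape R d n t -> preshape R d n t -> R) : Prop := {
  pm_refl : forall x, D x x = 0;
  pm_sym : forall x y, D x y = D y x;
  pm_triangle : forall y x z, D x z <= D x y + D y z;
  pm_transl : forall w x y, D (x + w) (y + w) = D x y;
  pm_scale : forall a x y, D (a *: x) (a *: y) = `|a| * D x y;
  pm_ge : forall (x y : preshape R d n t) e, enorm (x e - y e) <= D x y;
  pm_le : forall x y, D x y <= dist1 x y;
  pm_relabel : forall x y x' y' : preshape R d n t,
    (forall F : 'M[R]_(n, d) * 'M[R]_(n, d) -> R, F 0 = 0 ->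
      \sum_e F (x e, y e) = \sum_e F (x' e, y' e)) -> D x y = D x' y'
}.

Section Dist.
Variables (R : realType) (d n : nat) (t : btree).
Local Notation X := (preshape R d n t).
Implicit Types x y z w : X.

Lemma enorm_transl x y w e : enorm ((x + w) e - (y + w) e) = enorm (x e - y e).
Proof. by rewrite !ffunE opprD addrACA subrr addr0. Qed.

Lemma enorm_scale a x y e :
  enorm ((a *: x) e - (a *: y) e) = `|a| * enorm (x e - y e).
Proof. by rewrite !ffunE -scalerBr enormZ. Qed.

Lemma enorm_triangle y x z e :
  enorm (x e - z e) <= enorm (x e - y e) + enorm (y e - z e).
Proof. by rewrite (le_trans _ (enormD _ _))// addrA subrK. Qed.

Lemma dist1_metric : preshape_metric (@dist1 R d n t).
Proof.
rewrite /dist1; split.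
- by move=> x; rewrite big1 // => e _; rewrite subrr enorm0.
- by move=> x y; apply: eq_bigr => e _; rewrite enormB.
- by move=> y x z; rewrite -big_split; apply: ler_sum => e _; apply: enorm_triangle.
- by move=> w x y; apply: eq_bigr => e _; rewrite enorm_transl.
- by move=> a x y; rewrite mulr_sumr; apply: eq_bigr => e _; rewrite enorm_scale.
- by move=> x y e; rewrite (bigD1 e)//= lerDl sumr_ge0// => *; apply: enorm_ge0.
- by [].
- move=> x y x' y' /(_ (fun p => enorm (p.1 - p.2))); apply.
  by rewrite subrr enorm0.
Qed.

Lemma dist2_metric : preshape_metric (@dist2 R d n t).
Proof.
rewrite /dist2; split.
- move=> x; rewrite big1 ?sqrtr0// => e _.
  by rewrite subrr enorm0 expr0n.
- by move=> x y; congr Num.sqrt; apply: eq_bigr => e _; rewrite enormB.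
- move=> y x z.
  rewrite (le_trans _ (minkowski_sum _ _))// ler_wsqrtr// ler_sum// => e _.
  by rewrite lerXn2r ?nnegrE ?addr_ge0 ?enorm_ge0// enorm_triangle.
- by move=> w x y; congr Num.sqrt; apply: eq_bigr => e _; rewrite enorm_transl.
- move=> a x y; rewrite -[`|a|]sqrtr_sqr -sqrtrM ?sqr_ge0// mulr_sumr.
  by congr Num.sqrt; apply: eq_bigr => e _; rewrite enorm_scale exprMn real_normK ?num_real.
- move=> x y e; rewrite -[leLHS]ger0_norm ?enorm_ge0// -sqrtr_sqr ler_wsqrtr//.
  by rewrite (bigD1 e)//= lerDl sumr_ge0// => *; apply: sqr_ge0.
- by move=> x y; apply: le_sqrt_sum_sqr => e; apply: enorm_ge0.
- move=> x y x' y' /(_ (fun p => enorm (p.1 - p.2) ^+ 2)) h.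
  by congr Num.sqrt; apply: h; rewrite subrr enorm0 expr0n.
Qed.

End Dist.

(** * The quotient metric *)

Section ShapeSim.
Variables (R : realType) (d n : nat) (t : btree).
Local Notation X := (preshape R d n t).
Local Notation "\cl x" := (shape_class x) (at level 10).
Implicit Types x y z : X.

Lemma shape_classP x y : reflect (\cl x = \cl y) (shape_sim x y).
Proof. exact: (@eqquotP _ (shape_equiv R d n t) (treeshape R d n t)). Qed.

Lemma shape_class_repr (a : treeshape R d n t) : \cl (repr a) = a.
Proof. exact: reprK. Qed.

Lemma shape_sim_scale (a : R) x y : shape_sim x y -> shape_sim (a *: x) (a *: y).
Proof.
move=> /asboolP xy; apply/asboolP; rewrite /collapsed_tree.
have scaleE z : collapsed_children (a *: z) = otree_contract ( *:%R a) (collapsed_tree z).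
  rewrite contract_collapsed ?scaler0//; congr collapsed_children.
  by apply/funext => e; rewrite /= ffunE.
by rewrite !scaleE xy.
Qed.

Lemma shape_sim_sum (V : nmodType) (F : 'M[R]_(n, d) -> V) x y :
  shape_sim x y -> F 0 = 0 -> \sum_e F (x e) = \sum_e F (y e).
Proof. by move=> /asboolP xy F0; rewrite !sum_collapsed// xy. Qed.

Lemma shape_sim_values x y e :
  shape_sim x y -> y e != 0 -> exists e', x e' = y e.
Proof.
move=> xy ye; apply: contrapT => xne.
(* The number of edges that carry the nonzero value [y e] is an invariant of the class; it is
   positive for [y]. *)
have := shape_sim_sum (F := fun v => nat_of_bool ((v != 0) && (v == y e))) xy.
rewrite eqxx => /(_ erefl).
rewrite big1 => [|e' _]; last first.
  by case: (x e' =P y e) => [h|_]; [case: xne; exists e'|rewrite andbF].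
rewrite (bigD1 e)//= ye eqxx.
by [].
Qed.

(** The pairs [(x e, y e)] vanish exactly where [x] does, so their collapsed tree is that of [x],
    hence that of [x'], with a second attribute. Lifting it along [x'] gives [y'] as second
    component. *)
Lemma shape_sim_transport (D : X -> X -> R) x x' y :
    preshape_metric D -> shape_sim x x' -> (forall e, x e = 0 -> y e = 0) ->
  exists2 y', shape_sim y y' & D x' y' = D x y.
Proof.
move=> hD /asboolP xx' xy.
pose w0 e := (x e, y e).
have w0x : otree_map fst (collapsed_tree w0) = collapsed_tree x'.
  by rewrite map_collapsed ?xx'// => e /= xe; rewrite /w0 xe xy.
have [w wx' ww0] := collapsed_lift w0x.
have wE e : w e = (x' e, (w e).2).
  by rewrite [LHS]surjective_pairing; congr pair; rewrite -wx'.
exists [ffun e => (w e).2].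
  apply/asboolP; rewrite /collapsed_tree; congr ONode.
  have : otree_contract snd (collapsed_tree w) = otree_contract snd (collapsed_tree w0).
    by rewrite ww0.
  rewrite !contract_collapsed// => w_w0; rewrite -[LHS]w_w0.
  by congr collapsed_children; apply/funext => e; rewrite /= ffunE.
apply: (pm_relabel hD) => F F0.
under eq_bigr => e _ do rewrite ffunE -wE.
by rewrite !sum_collapsed// ww0 -sum_collapsed.
Qed.

Lemma shape_sim_norm (D : X -> X -> R) x y :
  preshape_metric D -> shape_sim x y -> D x 0 = D y 0.
Proof.
move=> hD xy; apply: (pm_relabel hD) => F F0.
have := shape_sim_sum (F := fun v => F (v, 0)) xy F0.
by under eq_bigr => e _ do rewrite -(ffunE (fun=> 0) e); move=> ->;
  apply: eq_bigr => e _; rewrite ffunE.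
Qed.

End ShapeSim.

Section QuotientMetric.
Variables (R : realType) (d n : nat) (t : btree).
Local Notation X := (preshape R d n t).
Local Notation "\cl x" := (shape_class x) (at level 10).
Variables (D : X -> X -> R) (hD : preshape_metric D).
Implicit Types (x y z : X) (a b c : treeshape R d n t).

Lemma preshape_metric_ge0 x y : 0 <= D x y.
Proof.
have := pm_triangle hD y x x.
by rewrite (pm_refl hD) (pm_sym hD y) -mulr2n pmulrn_lge0.
Qed.

Lemma chain_lengths1 x y : chain_lengths D (\cl x) (\cl y) (D x y).
Proof.
by exists 1%N, (fun=> x), (fun=> y); split=> //; rewrite big_ord_recl big_ord0 addr0.
Qed.

Lemma chain_lengths_cons x y b s :
  chain_lengths D (\cl y) b s -> chain_lengths D (\cl x) b (D x y + s).
Proof.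
move=> [k [u [v [k0 uy uv vb ->]]]].
exists k.+1, (fun i => if i is j.+1 then u j else x),
  (fun i => if i is j.+1 then v j else y); split=> //.
- by move=> [|i] ik; [apply/shape_classP|apply: uv].
- by case: k k0 vb {uv}.
- by rewrite big_ord_recl.
Qed.

(** The first jump is peeled off. Its end is equivalent to the start of the next jump, so the
    remaining chain starts in the class of [y]. *)
Lemma chain_lengths_ind (P : treeshape R d n t -> treeshape R d n t -> R -> Prop) :
  (forall x y, P (\cl x) (\cl y) (D x y)) ->
  (forall x y b s, chain_lengths D (\cl y) b s -> P (\cl y) b s ->
    P (\cl x) b (D x y + s)) ->
  forall a b s, chain_lengths D a b s -> P a b s.
Proof.
move=> P1 Pcons a b s [k [u [v [k0 <- uv <- ->]]]].
elim: k u v k0 uv => [//|[|k] IH] u v _ uv.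
  by rewrite big_ord_recl big_ord0 addr0.
have /shape_classP uv0 := uv 0%N isT.
have uvS i : (i.+1 < k.+1)%N -> shape_sim (v i.+1) (u i.+2) by move=> ik; apply: uv.
rewrite big_ord_recl; apply: Pcons; rewrite uv0; last exact: (IH (u \o S) (v \o S)).
by exists k.+1, (u \o S), (v \o S).
Qed.

Lemma chain_lengths_cat a b c r s :
  chain_lengths D a b r -> chain_lengths D b c s -> chain_lengths D a c (r + s).
Proof.
move=> ab; elim/chain_lengths_ind: ab s => [x y s|x y b' r' _ IH s] bc.
  exact: chain_lengths_cons.
by rewrite -addrA; apply/chain_lengths_cons/IH.
Qed.

Lemma chain_lengths_sym a b s : chain_lengths D a b s -> chain_lengths D b a s.
Proof.
elim/chain_lengths_ind => [x y|x y b' r _ IH].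
  by rewrite (pm_sym hD); exact: chain_lengths1.
rewrite addrC (pm_sym hD); apply: chain_lengths_cat IH _; exact: chain_lengths1.
Qed.

Lemma chain_lengths_ge0 a b s : chain_lengths D a b s -> 0 <= s.
Proof.
elim/chain_lengths_ind => [x y|x y b' r _ r0]; last apply: addr_ge0 => //;
  exact: preshape_metric_ge0.
Qed.

Lemma chain_lengths_neq0 a b : chain_lengths D a b !=set0.
Proof.
exists (D (repr a) (repr b)).
by rewrite -[X in chain_lengths _ X]shape_class_repr -[X in chain_lengths _ _ X]shape_class_repr;
  exact: chain_lengths1.
Qed.

Lemma quot_dist_le a b s : chain_lengths D a b s -> quot_dist D a b <= s.
Proof.
by move=> h; apply: ge_inf => //; exists 0 => r /chain_lengths_ge0.
Qed.

Lemma le_quot_dist a b m :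
  (forall s, chain_lengths D a b s -> m <= s) -> m <= quot_dist D a b.
Proof. by move=> h; apply: lb_le_inf => //; exact: chain_lengths_neq0. Qed.

Lemma quot_dist_lt a b m :
  quot_dist D a b < m -> exists2 s, chain_lengths D a b s & s < m.
Proof.
move=> h; apply: contrapT => hn; move: h; rewrite ltNge => /negP; apply.
by apply: le_quot_dist => s sab; rewrite leNgt; apply/negP => sm; apply: hn; exists s.
Qed.

Lemma quot_dist_class x y : quot_dist D (\cl x) (\cl y) <= D x y.
Proof. exact/quot_dist_le/chain_lengths1. Qed.

Lemma quot_dist_ge0 a b : 0 <= quot_dist D a b.
Proof. by apply: le_quot_dist => s /chain_lengths_ge0. Qed.

Lemma quot_dist_triangle b a c :
  quot_dist D a c <= quot_dist D a b + quot_dist D b c.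
Proof.
rewrite -lerBlDl; apply: le_quot_dist => s bc; rewrite lerBlDl -lerBlDr.
apply: le_quot_dist => r ab; rewrite lerBlDr.
exact/quot_dist_le/(chain_lengths_cat ab).
Qed.

Lemma quot_dist_sym a b : quot_dist D a b = quot_dist D b a.
Proof.
by apply/eqP; rewrite eq_le; apply/andP; split;
  apply: le_quot_dist => s /chain_lengths_sym; exact: quot_dist_le.
Qed.

Section Separation.
Variables (x : X) (delta : R).
Hypothesis delta_x : forall e, x e != 0 -> delta <= enorm (x e).

(* A point [x'] of the class of [x] which is closer to [z] than [delta] has its
   support inside that of [z], so a relabelling of [z] carries [x'] along. *)
Lemma near_class_transport x' z z' r :
  shape_sim x x' -> D x' z <= r -> r < delta -> shape_sim z z' ->
  exists2 x'', shape_sim x x'' & D x'' z' <= r.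
Proof.
move=> xx' x'z rdelta zz'.
have supp e : z e = 0 -> x' e = 0.
  move=> ze; apply/eqP; apply/negPn/negP => x'e.
  have [e' xe'] := shape_sim_values xx' x'e.
  have := le_trans (pm_ge hD x' z e) x'z; rewrite ze subr0 leNgt => /negP; apply.
  by rewrite (lt_le_trans rdelta)// -xe' delta_x// xe'.
have [x'' x'x'' x''z'] := shape_sim_transport hD zz' supp.
exists x''; last by rewrite (pm_sym hD) x''z' (pm_sym hD).
exact: shape_sim_trans xx' x'x''.
Qed.

(** Here [r] is the length already travelled. The total stays below [delta], so at each change of
    representative the nearby member of the class of [x] can be transported. *)
Lemma near_class_chain a b s : chain_lengths D a b s ->
  forall r z z', \cl z = a -> \cl z' = b -> r + s < delta ->
  (exists2 x', shape_sim x x' & D x' z <= r) ->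
  exists2 x', shape_sim x x' & D x' z' <= r + s.
Proof.
elim/chain_lengths_ind => [u v|u v b' s' vb IH] r z z' /shape_classP za.
  move=> /esym/shape_classP z'b rs [x' xx' x'z].
  have rdelta : r < delta by rewrite (le_lt_trans _ rs)// lerDl preshape_metric_ge0.
  have [x1 xx1 x1u] := near_class_transport xx' x'z rdelta za.
  apply: near_class_transport rs z'b; first exact: xx1.
  by rewrite (le_trans (pm_triangle hD u _ _))// lerD2r.
move=> z'b rs [x' xx' x'z].
have s0 := chain_lengths_ge0 vb.
have rdelta : r < delta.
  by rewrite (le_lt_trans _ rs)// lerDl addr_ge0// preshape_metric_ge0.
have [x1 xx1 x1u] := near_class_transport xx' x'z rdelta za.
rewrite addrA; apply: IH z'b _ _; [by []|by rewrite -addrA|].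
exists x1 => //.
by rewrite (le_trans (pm_triangle hD u _ _))// lerD2r.
Qed.

End Separation.

Lemma quot_dist_sep a b : quot_dist D a b = 0 -> a = b.
Proof.
rewrite -(shape_class_repr a) -(shape_class_repr b).
set x := repr a; set y := repr b => xy0.
(* [None] adds the value 0 to those of [x] and [y], so one minimum [delta] bounds from below both
   the nonzero attributes of [x] and the nonzero differences with attributes of [y]. *)
pose xo i := if i is Some e then x e else 0; pose yo i := if i is Some e then y e else 0.
have [delta delta0 hdelta] :=
  finite_pos_lower_bound (fun p : option (edge t) * option (edge t) =>
    enorm (xo p.1 - yo p.2)).
have pos (v : 'M[R]_(n, d)) : v != 0 -> 0 < enorm v.
  by move=> v0; rewrite lt_def enorm_ge0 andbT; apply: contra_neq v0; exact: enorm_eq0.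
have delta_x e : x e != 0 -> delta <= enorm (x e).
  by move=> /pos; have := hdelta (Some e, None); rewrite /= subr0; apply.
have [s chs sdelta] : exists2 s, chain_lengths D (\cl x) (\cl y) s & s < delta.
  by apply: quot_dist_lt; rewrite xy0.
have [x' xx' x'y] : exists2 x', shape_sim x x' & D x' y <= 0 + s.
  apply: (near_class_chain delta_x chs (z := x)) => //; first by rewrite add0r.
  by exists x; [exact: shape_sim_refl|rewrite (pm_refl hD)].
(* Each attribute of [x'] is 0 or an attribute of [x]; where it differs from that of [y], the
   distance would be at least [delta]. *)
suff <- : x' = y by apply/shape_classP.
apply/ffunP => e.
have [i x'e] : exists i, x' e = xo i.
  have [->|x'e] := eqVneq (x' e) 0; first by exists None.
  by have [e' <-] := shape_sim_values xx' x'e; exists (Some e').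
apply/eqP; rewrite -subr_eq0; apply/negPn/negP => /pos h.
have := pm_ge hD x' y e; rewrite leNgt => /negP; apply.
rewrite (le_lt_trans x'y)// add0r (lt_le_trans sdelta)//.
by have := hdelta (i, Some e); rewrite /= -x'e; apply.
Qed.

Lemma quot_dist_metric : is_metric (quot_dist D).
Proof.
split.
- move=> a; apply/eqP; rewrite eq_le quot_dist_ge0 andbT.
  rewrite -(pm_refl hD (repr a)) -[X in quot_dist _ X X]shape_class_repr.
  exact: quot_dist_class.
- exact: quot_dist_sep.
- exact: quot_dist_sym.
- exact: quot_dist_triangle.
Qed.

(** A jump changes the distance to 0 by at most its length, and passing to an equivalent pre-shape
    does not change it. *)
Lemma chain_lengths_norm a b s : chain_lengths D a b s ->
  forall x y, \cl x = a -> \cl y = b -> D y 0 <= D x 0 + s.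
Proof.
elim/chain_lengths_ind => [u v|u v b' s' _ IH] x y /shape_classP xu.
  move=> /shape_classP yv; rewrite (shape_sim_norm hD xu) (shape_sim_norm hD yv).
  by rewrite addrC (pm_sym hD u v) (pm_triangle hD).
move=> yb; rewrite (le_trans (IH v y erefl yb))// addrA lerD2r.
by rewrite (shape_sim_norm hD xu) addrC (pm_sym hD u v) (pm_triangle hD).
Qed.

Lemma quot_dist_norm x y : D y 0 <= D x 0 + quot_dist D (\cl x) (\cl y).
Proof.
rewrite -lerBlDl; apply: le_quot_dist => s xy; rewrite lerBlDl.
exact: chain_lengths_norm xy _ _ erefl erefl.
Qed.

Lemma quot_dist_scale (r : R) x y :
  quot_dist D (\cl (r *: x)) (\cl (r *: y)) <= `|r| * quot_dist D (\cl x) (\cl y).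
Proof.
have scale_chain a b s : chain_lengths D a b s -> forall x y,
    \cl x = a -> \cl y = b ->
    chain_lengths D (\cl (r *: x)) (\cl (r *: y)) (`|r| * s).
  have scl u v : \cl u = \cl v -> \cl (r *: u) = \cl (r *: v).
    by move=> /shape_classP/(shape_sim_scale r)/shape_classP.
  elim/chain_lengths_ind => [u v|u v b' s' _ IH] x' y' /scl ->.
    by move=> /scl ->; rewrite -(pm_scale hD); exact: chain_lengths1.
  move=> yb; rewrite mulrDr -(pm_scale hD); exact/chain_lengths_cons/IH.
have [->|r0] := eqVneq r 0.
  rewrite normr0 mul0r !scale0r; apply: (le_trans (quot_dist_class _ _)).
  by rewrite (pm_refl hD).
rewrite -ler_pdivrMl ?normr_gt0//; apply: le_quot_dist => s xy.
rewrite ler_pdivrMl ?normr_gt0//; apply: quot_dist_le.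
exact: scale_chain xy _ _ erefl erefl.
Qed.

Lemma preshape_metric_line (r s : R) x : D (r *: x) (s *: x) = `|r - s| * D x 0.
Proof.
have := pm_transl hD (s *: x) ((r - s) *: x) 0.
by rewrite -scalerDl subrK add0r => ->; rewrite -(pm_scale hD) scaler0.
Qed.

End QuotientMetric.

(** * Proper and geodesic metric spaces *)

(** Compactness gives a cluster point. If a neighbourhood [N] of it were not in the image
    ultrafilter, its complement would be, and would have to meet [N]. *)
Lemma ultra_lim (I : Type) (U : set_system I) (T : topologicalType) (f : I -> T)
    (A : set T) :
  UltraFilter U -> compact A -> U (f @^-1` A) -> exists2 p, A p & f @ U --> p.
Proof.
move=> UU cA UA; have [p [Ap clp]] := cA (f @ U) _ UA.
exists p => // N pN.
have [//|UnN] := in_ultra_setVsetC (f @^-1` N) UU.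
by have [q [nNq Nq]] := clp (~` N) N UnN pN.
Qed.

Section MetricSpaces.
Variables (R : realType) (M : metricType R).
Implicit Types (x y z : M) (A : set M).

Lemma closed_mdist_ball x (r : R) : closed [set y | mdist x y <= r].
Proof.
move=> y cly; apply/ler_addgt0Pr => e e0.
have [z [/= xz yz]] := cly _ (nbhsx_ballx y _ e0).
rewrite ballEmdist/= metric_sym in yz.
by rewrite (le_trans (metric_triangle _ z _))// lerD// ltW.
Qed.

Lemma proper_compact_ball x (r : R) :
  proper_space M -> compact [set y | mdist x y <= r].
Proof.
move=> pM; apply: pM; first exact: closed_mdist_ball.
exists (r + r) => y z /= xy xz.
by rewrite (le_trans (metric_triangle _ x _))// lerD// metric_sym.
Qed.

Lemma cauchy_mdist (F : set_system M) (e : R) : ProperFilter F -> cauchy F ->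
  0 < e -> exists2 S, F S & forall x y, S x -> S y -> mdist x y < e.
Proof.
move=> FF cF e0.
have [[P Q] [/= FP FQ] PQ] := cF _ (entourage_ball M (PosNum e0)).
exists (P `&` Q); first exact: filterI.
move=> x y [Px _] [_ Qy].
by have := PQ (x, y) (conj Px Qy); rewrite /= ballEmdist.
Qed.

(** An ultrafilter finer than the Cauchy filter contains a closed ball, which is compact, so it
    converges; the Cauchy property carries the limit back to the original filter. *)
Lemma proper_complete : proper_space M -> complete_space M.
Proof.
move=> pM F FF cF.
have [G [GU FG]] := ultraFilterLemma FF.
have [S FS S1] := cauchy_mdist FF cF ltr01.
have [x Sx] := filter_ex FS.
have GB : G [set y | mdist x y <= 1].
  by apply: FG; apply: filterS FS => y Sy; apply/ltW/S1.
have [l _ Gl] := ultra_lim (f := id) GU (proper_compact_ball pM) GB.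
exists l; apply/metricType_numDomainType.fcvgrPdist_lt => e e0.
have e20 : 0 < e / 2 by rewrite divr_gt0.
have [S' FS' S'e] := cauchy_mdist FF cF e20.
have [y [ly S'y]] := filter_ex (filterI (Gl _ (nbhsx_ballx l _ e20)) (FG _ FS')).
apply: filterS FS' => z S'z.
rewrite (le_lt_trans (metric_triangle _ y _))// (splitr e) ltrD//; last exact: S'e.
by rewrite /= ballEmdist in ly.
Qed.

Lemma lipschitz_continuous (f : R -> M) (L : R) :
  (forall s t, mdist (f s) (f t) <= L * `|s - t|) -> continuous f.
Proof.
move=> fL s; apply/metricType_numDomainType.cvgrPdist_lt => e e0.
(* The sign of [L] is not known, and the radius needs a positive denominator. *)
have L0 : 0 < `|L| + 1 by rewrite ltr_wpDl.
have := nbhsx_ballx s _ (divr_gt0 e0 L0); apply: filterS => t.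
rewrite /ball /= => st; rewrite (le_lt_trans (fL _ _))//.
rewrite ltr_pdivlMr// mulrC in st; apply: le_lt_trans st.
by rewrite ler_wpM2r// (le_trans (ler_norm L))// lerDl.
Qed.

Lemma lipschitz_path_variation (f : R -> M) (L a b : R) s :
  (forall s t, mdist (f s) (f t) <= L * `|s - t|) -> itv_partition a b s ->
  path_variation a b f s <= L * (b - a).
Proof.
move=> fL; elim: s a => [|c s IH] a abs.
  by rewrite /path_variation big_nil (itv_partition_nil abs) subrr mulr0.
have ac : a <= c by case: abs => /= /andP[/ltW].
have := IH _ (itv_partition_cons abs); rewrite /path_variation /= => IHs.
rewrite big_nat_recl//= -(subrKA c b) mulrDr addrC lerD//.
by rewrite (le_trans (fL _ _))// distrC ger0_norm// subr_ge0.
Qed.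

(** The Lipschitz constant bounds every variation from above; the one-interval partition attains the
    bound. *)
Lemma lipschitz_path_length (f : R -> M) :
  (forall s t, mdist (f s) (f t) <= mdist (f 0) (f 1) * `|s - t|) ->
  path_length 0 1 f = (mdist (f 0) (f 1))%:E.
Proof.
move=> fL; apply/eqP; rewrite eq_le; apply/andP; split.
  apply: ge_ereal_sup => _ [s ps <-]; rewrite lee_fin.
  by rewrite (le_trans (lipschitz_path_variation fL ps))// subr0 mulr1.
apply: ereal_sup_ubound; exists [:: 1]; first exact: itv_partition1.
by rewrite /path_variation big_nat1.
Qed.

(* A limit of the almost shortest paths along an ultrafilter of errors tending
   to 0 is a shortest path; it exists since balls are compact. *)
Lemma proper_geodesic : proper_space M ->
  (forall x y (e : R), 0 < e -> exists f : R -> M, [/\ f 0 = x, f 1 = y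
    & forall s t, mdist (f s) (f t) <= (mdist x y + e) * `|s - t|]) ->
  geodesic_space M.
Proof.
move=> pM approx x y; set L := mdist x y.
have [F hF] : exists F : R -> R -> M, forall e, 0 < e -> [/\ F e 0 = x, F e 1 = y
    & forall s t, mdist (F e s) (F e t) <= (L + e) * `|s - t|].
  (* Choice needs a path for every real [e]; for [e <= 0] a constant one is a dummy. *)
  have /choice[F hF] : forall e : R, exists f : R -> M, 0 < e -> [/\ f 0 = x, f 1 = y
      & forall s t, mdist (f s) (f t) <= (L + e) * `|s - t|].
    move=> e; have [e0|_] := ltP 0 e; last by exists (fun=> x).
    by have [f hf] := approx x y e e0; exists f.
  by exists F.
have [U [UU Ule]] := ultraFilterLemma (at_right_proper_filter (0 : R)).
have Ugt0 : U [set e : R | 0 < e] by apply: Ule; exact: nbhs_right_gt.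
have Ult (eta : R) : 0 < eta -> U [set e : R | e < eta].
  by move=> eta0; apply: Ule; exact: nbhs_right_lt.
have /choice[g gU] : forall s : R, exists p : M, F ^~ s @ U --> p.
  (* For errors below 1, [F e s] is within [(L + 1) * |s|] of [F e 0 = x]. *)
  move=> s; have cB := @proper_compact_ball x ((L + 1) * `|s|) pM.
  have [|p _ Fp] := ultra_lim (f := F ^~ s) UU cB; last by exists p.
  apply: filterS (filterI Ugt0 (Ult _ ltr01)) => e [/= e0 e1].
  have [F0 _ Fe] := hF e e0.
  rewrite -F0 (le_trans (Fe _ _))// sub0r normrN ler_wpM2r// lerD2l.
  exact: ltW.
have Fg t eta : 0 < eta -> U [set e | mdist (g t) (F e t) < eta].
  by move=> eta0; have /metricType_numDomainType.cvgrPdist_lt := gU t; apply.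
have fixed t p : (forall e, 0 < e -> F e t = p) -> g t = p.
  move=> Fp; apply: mdist_positivity; apply/eqP.
  rewrite eq_le mdist_ge0 andbT; apply/ler_addgt0Pr => eta eta0.
  have [e [/= e0 ge]] := filter_ex (filterI Ugt0 (Fg t eta eta0)).
  by rewrite add0r -(Fp e e0) ltW.
have g0 : g 0 = x by apply: fixed => e /hF[].
have g1 : g 1 = y by apply: fixed => e /hF[].
have gL s t : mdist (g s) (g t) <= mdist (g 0) (g 1) * `|s - t|.
  rewrite g0 g1; apply/ler_addgt0Pr => eps eps0.
  have k0 : 0 < `|s - t| + 2 by rewrite ltr_wpDl.
  (* The budget [eps] pays [eta] for each of the two approximations, at [s] and at [t], and
     [eta * |s - t|] for the excess [e] of the Lipschitz constant. *)
  pose eta := eps / (`|s - t| + 2).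
  have eta0 : 0 < eta by rewrite divr_gt0.
  have [e [[/= e0 ee] [/= se te]]] :=
    filter_ex (filterI (filterI Ugt0 (Ult _ eta0)) (filterI (Fg s _ eta0) (Fg t _ eta0))).
  have [_ _ Fe] := hF e e0.
  have -> : eps = eta + eta * `|s - t| + eta.
    by rewrite /eta; field; rewrite gt_eqF.
  rewrite metric_sym in te.
  have := metric_triangle (g s) (F e s) (g t).
  have := metric_triangle (F e s) (F e t) (g t).
  have := Fe s t; rewrite mulrDl.
  have : e * `|s - t| <= eta * `|s - t| by rewrite ler_wpM2r// ltW.
  rewrite -/L; move: se te; lra.
exists g; split=> //.
- exact/continuous_subspaceT/lipschitz_continuous/gL.
- by rewrite lipschitz_path_length// g0 g1.
Qed.

(** For parameters on both sides of [c], the triangle inequality is applied through the common point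
    [f c = g 0]. *)
Lemma lipschitz_glue (f g : R -> M) (c : R) : f c = g 0 ->
  (forall s t, mdist (f s) (f t) <= `|s - t|) ->
  (forall s t, mdist (g s) (g t) <= `|s - t|) ->
  let h s := if s <= c then f s else g (s - c) in
  forall s t, mdist (h s) (h t) <= `|s - t|.
Proof.
move=> fg fL gL h.
have mixed s t : s <= c -> c < t -> mdist (f s) (g (t - c)) <= `|s - t|.
  move=> sc ct; have st : s <= t by rewrite (le_trans sc)// ltW.
  rewrite (distrC s) ger0_norm ?subr_ge0// [leRHS](_ : _ = (c - s) + (t - c)); last by ring.
  apply: (le_trans (metric_triangle _ (f c) _)); apply: lerD.
    by rewrite (le_trans (fL _ _))// distrC ger0_norm// subr_ge0.
  by rewrite fg (le_trans (gL _ _))// sub0r normrN ger0_norm// subr_ge0 ltW.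
move=> s t; rewrite /h; case: (leP s c) => sc; case: (leP t c) => tc //.
- exact: mixed.
- by rewrite metric_sym distrC; exact: mixed.
- by rewrite (le_trans (gL _ _))// opprB addrA subrK.
Qed.

End MetricSpaces.

(** * The space of tree-like shapes *)

Section TreeShapes.
Variables (R : realType) (d n : nat) (t : btree).
Local Notation X := (preshape R d n t).
Local Notation "\cl x" := (shape_class x) (at level 10).
Variables (D : X -> X -> R) (hD : preshape_metric D).
Let M : metricType R := metric_space (quot_dist_metric hD).
Implicit Types (x y : X) (a b : M).

(** Along an ultrafilter on [A], the coordinates of arbitrarily chosen representatives are bounded,
    so they converge. The class of the limit is the limit of the shapes, because the projection is
    1-Lipschitz. *)
Lemma tree_shapes_proper : proper_space M.
Proof.
move=> A clA [r Ar]; rewrite compact_ultra => U UU UA.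
have [a0 Aa0] := filter_ex UA.
pose c := D (repr a0) 0 + r.
have Ac a : A a -> D (repr a) 0 <= c.
  move=> Aa; rewrite (le_trans (quot_dist_norm hD (repr a0) (repr a)))// lerD2l.
  by rewrite !shape_class_repr; apply: Ar.
pose co (p : edge t * ('I_n * 'I_d)) a : R := (repr a : X) p.1 p.2.1 p.2.2.
have /choice[l Ul] : forall p, exists q : R, co p @ U --> q.
  move=> p; have [|q _ Uq] := ultra_lim (f := co p) UU (segment_compact (a := - c) (b := c)).
    apply: filterS UA => a /Ac ac; rewrite /= in_itv /= -ler_norml.
    apply: le_trans ac; apply: le_trans (pm_ge hD (repr a) 0 p.1).
    apply: le_trans (enorm_ge_entry _ p.2.1 p.2.2).
    by rewrite ffunE subr0.
  by exists q.
pose x : X := [ffun e => \matrix_(i, j) l (e, (i, j))].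
have Ux : U --> (\cl x : M).
  apply/metricType_numDomainType.fcvgrPdist_lt => eps eps0.
  pose k := (n * d * #|edge t|)%N.
  (* The successor avoids dividing by 0 and keeps the total [k * eta] strictly below [eps]. *)
  pose eta := eps / k.+1%:R.
  have eta0 : 0 < eta by rewrite divr_gt0.
  have Ueta : U [set a | forall p, `|l p - co p a| < eta].
    apply: filter_forall => p; have /cvgrPdist_lt := Ul p; exact.
  apply: filterS Ueta => a /= leta.
  have -> : a = \cl (repr a) by rewrite shape_class_repr.
  apply: (le_lt_trans (quot_dist_class hD _ _)).
  apply: (le_lt_trans (pm_le hD _ _)).
  apply: (@le_lt_trans _ _ (\sum_(e : edge t) eta *+ (n * d))).
    apply: ler_sum => e _; apply: enorm_le_entries; first exact: ltW.
    by move=> i j; rewrite !mxE ffunE mxE; apply/ltW/leta.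
  rewrite sumr_const -mulrnA -/k -mulr_natr /eta mulrAC ltr_pdivrMr//.
  by rewrite ltr_pM2l// ltr_nat.
exists (\cl x); split=> //.
by apply: clA => N /Ux UN; exact: filter_ex (filterI UA UN).
Qed.

(** Each jump is replaced by the image of a straight segment parametrised by [D]-length, and
    consecutive segments meet in the quotient. *)
Lemma tree_shapes_path a b s : chain_lengths D a b s ->
  exists f : R -> M, [/\ f 0 = a, f s = b
    & forall u v, mdist (f u) (f v) <= `|u - v|].
Proof.
have step x y : exists f : R -> M, [/\ f 0 = \cl x, f (D x y) = \cl y
    & forall u v, mdist (f u) (f v) <= `|u - v|].
  have [xy0|xy0] := eqVneq (D x y) 0.
    exists (fun=> \cl x); split=> //.
      apply: (quot_dist_sep hD); apply/eqP; rewrite eq_le.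
      by rewrite (quot_dist_ge0 hD) -xy0 (quot_dist_class hD).
    by move=> u v; rewrite mdistxx.
  exists (fun u => \cl ((u / D x y) *: (y - x) + x)); split.
  - by rewrite mul0r scale0r add0r.
  - by rewrite divff// scale1r subrK.
  move=> u v; apply: (le_trans (quot_dist_class hD _ _)).
  rewrite (pm_transl hD) (preshape_metric_line hD) -mulrBl normrM.
  rewrite -[D (y - x) 0](pm_transl hD x) subrK add0r (pm_sym hD y x).
  by rewrite normfV (ger0_norm (preshape_metric_ge0 hD _ _)) divfK.
elim/(@chain_lengths_ind _ _ _ _ D) => [//|x y b' s' yb [g [g0 gs gL]]].
have [f [f0 fxy fL]] := step x y.
have s0 := chain_lengths_ge0 hD yb.
exists (fun u => if u <= D x y then f u else g (u - D x y)); split.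
- by rewrite (preshape_metric_ge0 hD).
(* The endpoint falls under the first branch only if the rest of the chain has length 0; then [g]
   starts and ends at the same point. *)
- rewrite addrC addrK; case: leP => // h.
  have s'0 : s' = 0 by apply/eqP; rewrite eq_le s0 andbT -(gerDr (D x y)).
  by rewrite s'0 add0r fxy -gs s'0 g0.
- by apply: lipschitz_glue; rewrite ?fxy ?g0.
Qed.

Lemma tree_shapes_geodesic : geodesic_space M.
Proof.
apply: proper_geodesic; first exact: tree_shapes_proper.
move=> a b e e0.
have /quot_dist_lt[s sab sL] : quot_dist D a b < mdist a b + e by rewrite ltrDl.
have [f [f0 fs fL]] := tree_shapes_path sab.
have s0 := chain_lengths_ge0 hD sab.
exists (fun u => f (u * s)); rewrite mul0r mul1r; split=> // u v.
rewrite (le_trans (fL _ _))// -mulrBl normrM mulrC ler_wpM2r//.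
by rewrite ger0_norm// ltW.
Qed.

(** Although representatives are chosen without continuity, the homotopy is continuous: scaling by
    [1 - u] is Lipschitz in the shape, and a fixed shape moves at speed at most [N] in the
    parameter. *)
Lemma tree_shapes_contractible : contractible R M.
Proof.
exists (\cl 0 : M), (fun p : M * R => \cl ((1 - p.2) *: (repr p.1 : X)) : M).
split; last 2 first.
- by move=> a; rewrite subr0 scale1r shape_class_repr.
- by move=> a; rewrite subrr scale0r.
apply: continuous_subspaceT => -[a s]; apply/metricType_numDomainType.cvgrPdist_lt => eps eps0.
pose N := D (repr a) 0.
have N0 : 0 <= N by exact: preshape_metric_ge0.
have N1 : 0 < N + 1 by rewrite ltr_wpDl.
have s1 : 0 < `|1 - s| + 1 by rewrite ltr_wpDl.
have e20 : 0 < eps / 2 by rewrite divr_gt0.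
(* The radius 1 around [s] yields the bound [|1 - s| + 1] on the scaling factors [|1 - u|]; [N + 1]
   is positive even if [N = 0]. *)
exists (ball a (eps / 2 / (`|1 - s| + 1)),
        ball s 1 `&` ball s (eps / 2 / (N + 1))).
  split=> /=; first by apply: nbhsx_ballx; rewrite divr_gt0.
  by apply: filterI; apply: nbhsx_ballx; rewrite ?divr_gt0.
move=> [b u] [/= ab [su1 su]].
rewrite ballEmdist/= ltr_pdivlMr// in ab; rewrite /ball/= ltr_pdivlMr// in su su1.
rewrite (le_lt_trans (metric_triangle _ (\cl ((1 - u) *: (repr a : X)) : M) _))//.
rewrite (splitr eps) ltr_leD//.
- apply: (le_lt_trans (quot_dist_class hD _ _)).
  rewrite (preshape_metric_line hD) -/N opprB addrC addrA subrK distrC.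
  apply: le_lt_trans su.
  by rewrite ler_wpM2l// lerDl.
- apply: (le_trans (quot_dist_scale hD _ _ _)); rewrite !shape_class_repr.
  apply: le_trans (ltW ab); rewrite mulrC ler_wpM2l ?(quot_dist_ge0 hD)//.
  have -> : 1 - u = (1 - s) + (s - u) by rewrite addrA subrK.
  by rewrite (le_trans (ler_normD _ _))// lerD2l ltW.
Qed.

End TreeShapes.

Theorem theorem10 (R : realType) (d n : nat) (t : btree)
    (hd : (1 <= d)%N) (hn : (1 <= n)%N) (ht : t <> Leaf)
    (D : preshape R d n t -> preshape R d n t -> R)
    (hD : D = @dist1 R d n t \/ D = @dist2 R d n t) :
  exists H : is_metric (quot_dist D),
    [/\ contractible R (metric_space H),
        complete_space (metric_space H),
        proper_space (metric_space H)
      & geodesic_space (metric_space H)].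
Proof.
have pmD : preshape_metric D.
  by case: hD => ->; [exact: dist1_metric|exact: dist2_metric].
exists (quot_dist_metric pmD); split.
- exact: tree_shapes_contractible.
- exact/proper_complete/tree_shapes_proper.
- exact: tree_shapes_proper.
- exact: tree_shapes_geodesic.
Qed.
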